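(* Let $n\ge 1$ be an integer and let $X$ be an $S(n)$-space. Then $X$ is a minimal $S(n)$-space if and only if for every infinite set $A\subseteq X$ both of the following hold: (i) $A$ $\theta(n)$-converges to the set $B$ of all its $\theta(n)$-complete accumulation points; (ii) whenever $x\in X$ is a point such that $A$ does not $\theta(n)$-converge to $X\setminus\{x\}$, then $x$ is a complete accumulation point of $A$.
   Context: All neighborhoods are open; $\overline{M}=\mathrm{cl}\,M$ is the closure in the space $X$. $\theta^n$-closure: $\mathrm{cl}_{\theta^0}M=\mathrm{cl}\,M$; for $n\ge 1$, $x\notin \mathrm{cl}_{\theta^n}M$ iff there are open neighborhoods $U_1,\dots,U_n$ of $x$ with $\mathrm{cl}\,U_i\subseteq U_{i+1}$ for $i=1,\dots,n-1$ and $\mathrm{cl}\,U_n\cap M=\emptyset$. The $\theta^n$-interior is $\mathrm{Int}_{\theta^n}M=X\setminus \mathrm{cl}_{\theta^n}(X\setminus M)$. For $n\ge1$, $X$ is an $S(n)$-space if $x\notin\mathrm{cl}_{\theta^n}\{y\}$ for any two distinct points $x,y\in X$. An $S(n)$-space is minimal $S(n)$ if its underlying set carries no strictly coarser $S(n)$ topology. An $n$-hull of a point $x$ is a neighborhood $U$ of $x$ for which there are neighborhoods $U_1,\dots,U_n=U$ of $x$ with $\mathrm{cl}\,U_i\subseteq U_{i+1}$ for $i=1,\dots,n-1$. A point $x$ is a $\theta(n)$-complete accumulation point of an infinite set $F$ if $|F\cap\overline U|=|F|$ for every $n$-hull $U$ of $x$. It is a complete accumulation point of $F$ if $|F\cap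 U|=|F|$ for every neighborhood $U$ of $x$. For $k\ge 0$, an $S(k)$-cover of a subset $B\subseteq X$ is a family $\{U_\alpha\}$ of open subsets of $X$ such that $B\subseteq\bigcup_\alpha \mathrm{Int}_{\theta^k}U_\alpha$. A set $A$ $\theta(n)$-converges to a set $B$ if for every $S(n-1)$-cover $\gamma$ of $B$ there is a finite family $\{U_{\alpha_i}\}_{i=1}^k\subseteq\gamma$ such that $|A\setminus \bigcup_{i=1}^k\overline{U_{\alpha_i}}|<|A|$. *)

(* Defs.v *)
From mathcomp Require Import all_boot all_order all_classical topology.

Set Implicit Arguments.
Unset Strict Implicit.
Unset Printing Implicit Defensive.

Local Open Scope classical_set_scope.
Local Open Scope card_scope.

Definition card_lt (T U : Type) (A : set T) (B : set U) : bool :=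
  (A #<= B) && (A #!= B).

(* U 1, ..., U n are open neighborhoods of x, each one containing the closure
   of the previous one. The values U i for i outside 1..n are irrelevant. *)
Definition nbhs_chain (X : topologicalType) (n : nat) (x : X)
    (U : nat -> set X) : Prop :=
  (forall i, (1 <= i <= n)%N -> open_nbhs x (U i)) /\
  (forall i, (1 <= i < n)%N -> closure (U i) `<=` U i.+1).

Definition theta_closure (X : topologicalType) (n : nat) (M : set X) : set X :=
  if n is 0 then closure M
  else [set x | ~ exists U : nat -> set X,
                    nbhs_chain n x U /\ closure (U n) `&` M = set0].

Definition theta_interior (X : topologicalType) (n : nat) (M : set X) : set X :=
  ~` theta_closure n (~` M).

(* Meant for n >= 1 only. *)
Definition S_space (n : nat) (X : topologicalType) : Prop :=
  forall x y : X, x <> y -> ~ theta_closure n [set y] x.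

(* A term of Topological.axioms_ X is a topology on the carrier of X (packed
   with eqType and choiceType structures, which play no role here). *)
Definition minimal_S_space (n : nat) (X : topologicalType) : Prop :=
  S_space n X /\
  ~ exists tau : Topological.axioms_ X,
      S_space n (Topological.Pack tau) /\
      @open (Topological.Pack tau) `<` @open X.

(* Meant for n >= 1 only. *)
Definition hull (X : topologicalType) (n : nat) (x : X) (V : set X) : Prop :=
  exists U : nat -> set X, nbhs_chain n x U /\ U n = V.

Definition theta_complete_accumulation (X : topologicalType) (n : nat)
    (F : set X) (x : X) : Prop :=
  forall U : set X, hull n x U -> F `&` closure U #= F.

Definition complete_accumulation (X : topologicalType)
    (F : set X) (x : X) : Prop :=
  forall U : set X, open_nbhs x U -> F `&` U #= F.

Definition S_cover (X : topologicalType) (k : nat) (B : set X)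
    (gamma : set (set X)) : Prop :=
  gamma `<=` open /\ B `<=` \bigcup_(U in gamma) theta_interior k U.

Definition theta_converges (X : topologicalType) (n : nat) (A B : set X)
    : Prop :=
  forall gamma : set (set X), S_cover n.-1 B gamma ->
    exists delta : set (set X),
      [/\ finite_set delta, delta `<=` gamma &
          card_lt (A `\` \bigcup_(U in delta) closure U) A].

(* Main.v *)
From HB Require Import structures.
Require Import Defs.
From mathcomp Require Import all_boot all_order all_classical topology zify.

(* Both sides are equivalent to the following property: for every point x, every
   S(n-1)-cover gamma of X \ {x} and every neighborhood W of x, the closures of
   finitely many members of gamma cover X \ W.
   - A cover for which it fails yields a strictly coarser S(n) topology, whose
     neighborhoods of x must also contain the complement of the closures of
     finitely many members of gamma; conversely, the n-hulls in a coarser S(n)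
     topology form a cover showing that it is not strictly coarser.
   - It implies (ii) at once, and (i) by enlarging a cover of B with the n-hulls
     whose closure meets A in fewer than |A| points.
   - Assuming (ii), let A be a subset of X \ W of least cardinality among those
     not covered by the closures of finitely many members of gamma. It is
     infinite and x is not a complete accumulation point of it, so A
     theta(n)-converges to X \ {x}: finitely many closures cover A up to a set
     of smaller cardinality, which is itself covered, a contradiction. *)

Set Implicit Arguments.
Unset Strict Implicit.
Unset Printing Implicit Defensive.
Local Open Scope classical_set_scope.
Local Open Scope card_scope.

(** * Comparison of cardinals and unions of infinite sets *)

Lemma set_inj_card_le (T U : Type) (A : set T) (B : set U) (f : T -> U) :
  set_fun A B f -> set_inj A f -> A #<= B.
Proof.
move=> fAB finj; have /injfunPex[g] := ex_intro2 _ _ f fAB finj.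
exact: inj_card_le.
Qed.

Lemma card_le_set_inj (T U : Type) (A : set T) (B : set U) :
  B !=set0 -> A #<= B -> exists2 f : T -> U, set_fun A B f & set_inj A f.
Proof.
elim/Ppointed: U => U in B *; first by rewrite emptyE => -[].
by move=> _ /pcard_leP/injfunPex.
Qed.

Lemma card_le_min (I T : Type) (i0 : I) (A : I -> set T) :
  exists i, forall j, A i #<= A j.
Proof.
(* A maximal set of points of the product of the A i on which all projections
   are injective: one of the projections is then onto. *)
pose P (S : set (I -> T)) := forall f g, S f -> S g ->
  forall i, A i (f i) /\ (f i = g i -> f = g).
have [|S [PS maxS]] := @Zorn_bigcup _ P.
  move=> F FP totF f g [Sf FSf Sff] [Sg FSg Sgg].
  by have [sub|sub] := totF _ _ FSf FSg;
    [apply: (FP _ FSg) => //; exact: sub|apply: (FP _ FSf) => //; exact: sub].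
suff [i Ai] : exists i, A i `<=` [set f i | f in S].
  exists i => j; apply: card_le_trans (subset_card_le Ai) _.
  apply: card_le_trans (card_image_le _ _) _.
  apply: (@set_inj_card_le _ _ _ _ (fun f => f j)) => [f Sf|f g].
    by have [] := PS f f Sf Sf j.
  by rewrite !inE => Sf Sg; have [_] := PS f g Sf Sg j.
apply: contrapT => noi.
have /choice[h hP] : forall i, exists x, A i x /\ forall f, S f -> f i <> x.
  move=> i; apply: contrapT => nx; apply: noi; exists i => x Aix.
  apply: contrapT => nimg; apply: nx; exists x; split=> // f Sf fx.
  by apply: nimg; exists f.
(* In each [A i], the value of [h] is missed by the projection of [S], so [h] can be added to [S];
   the index [i0] ensures that it is not there already. *)
apply: (maxS (S `|` [set h])).
  split; first by move=> f; left.
  move=> /(_ h (or_intror erefl)) Sh.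
  by have [_ /(_ _ Sh)] := hP i0.
move=> f g [Sf|->] [Sg|->] i.
- exact: PS.
- by have [Af _] := PS f f Sf Sf i; split=> // fh; have [_ /(_ _ Sf)] := hP i.
- by have [Ah /(_ _ Sg) gh] := hP i; split=> // /esym.
- by have [] := hP i.
Qed.

Lemma card_le_total (T : Type) (A B : set T) : A #<= B \/ B #<= A.
Proof.
have [[] /= h] := card_le_min true (fun b : bool => if b then A else B).
  by left; exact: h false.
by right; exact: h true.
Qed.

Lemma infinite_set_double (T : Type) (D : set T) : infinite_set D ->
  exists2 g : T * bool -> T, set_fun (D `*` setT) D g & set_inj (D `*` setT) g.
Proof.
move=> Dinf.
(* A maximal family of disjoint injective sequences in D covers D up to a finite
   set, so that D * bool embeds into S * (nat * bool * bool), hence into S * nat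
   and back into D. *)
pose P (S : set (nat -> T)) := forall s t, S s -> S t ->
  forall i j, D (s i) /\ (s i = t j -> s = t /\ i = j).
have [|S [PS maxS]] := @Zorn_bigcup _ P.
  move=> F FP totF f g [Sf FSf Sff] [Sg FSg Sgg].
  by have [sub|sub] := totF _ _ FSf FSg;
    [apply: (FP _ FSg) => //; exact: sub|apply: (FP _ FSf) => //; exact: sub].
pose E := [set x | exists2 s, S s & exists i, s i = x].
have Rfin : finite_set (D `\` E).
  apply: contrapT => /[dup] /infinite_setN0 R0 /infiniteP.
  move=> /(card_le_set_inj R0)[s sR sinj].
  apply: (maxS (S `|` [set s])).
    split; first by move=> f; left.
    move=> /(_ s (or_intror erefl)) Ss.
    by have [_] := sR 0%N I; apply; exists s => //; exists 0%N.
  move=> f g [Sf|->] [Sg|->] i j.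
  - exact: PS.
  - have [Df _] := PS f f Sf Sf i i; split=> // fh; exfalso.
    by have [_] := sR j I; apply; exists f => //; exists i.
  - have [Ds nE] := sR i I; split=> // sg; exfalso; apply: nE.
    by exists g => //; exists j.
  - have [Ds _] := sR i I; split=> // ij; split=> //.
    by apply: sinj => //; rewrite inE.
have [s0 Ss0] : S !=set0.
  apply: contrapT => S0; apply: Dinf; apply: sub_finite_set Rfin => x Dx.
  by split=> // -[s Ss _]; apply: S0; exists s.
have /card_le_set_inj[|idx _ idxinj] := finite_set_countable Rfin.
  by exists 0%N.
(* Code of a point of [D]: a sequence, an index and a flag. The flag is [true] for a term of the
   sequence, and [false] for a leftover point, which is attached to [s0] and numbered by [idx]. *)
have /choice[c cP] : forall x, exists si : (nat -> T) * nat * bool,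
    D x -> S si.1.1 /\ if si.2 then si.1.1 si.1.2 = x
           else [/\ si.1.1 = s0, (D `\` E) x & si.1.2 = idx x].
  move=> x; have [[s Ss [i si]]|nE] := pselect (E x).
    by exists (s, i, true).
  by exists (s0, idx x, false).
have cinj : set_inj D c.
  move=> x y /[!inE] /cP[_ cx] /cP[_ cy] cxy; move: cx; rewrite cxy.
  case: (c y).2 cy => [cy cx|[_ Ry ->] [_ Rx idxy]].
    exact: etrans (esym cx) cy.
  by apply: idxinj; rewrite ?inE.
exists (fun p => (c p.1).1.1 (pickle ((c p.1).1.2, (c p.1).2, p.2))).
  by move=> [x b] [/cP[Sc _] _] /=; exact: (PS _ _ Sc Sc _ 0%N).1.
move=> [x b] [y d] /[!inE] -[/= Dx _] [/= Dy _].
have [Sx _] := cP _ Dx; have [Sy _] := cP _ Dy.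
have [_ H] := PS _ _ Sx Sy (pickle ((c x).1.2, (c x).2, b))
  (pickle ((c y).1.2, (c y).2, d)).
move=> /H[e1 /(pcan_inj pickleK)[e2 e3 ->]]; congr pair.
apply: cinj; rewrite ?inE//.
by move: e1 e2 e3; case: (c x) => -[? ?] ?; case: (c y) => -[? ?] ? /= -> -> ->.
Qed.

(** Points of [B] go to one copy of [B] in [B * bool], the others to the second copy through [h];
    both copies fit into [B] together. *)
Lemma card_le_setU (T : Type) (A B : set T) :
  infinite_set B -> A #<= B -> A `|` B #<= B.
Proof.
move=> Binf AB; have [h hAB hinj] := card_le_set_inj (infinite_setN0 Binf) AB.
have [g gB ginj] := infinite_set_double Binf.
pose f x := if pselect (B x) then (x, true) else (h x, false).
have fB x : (A `|` B) x -> (B `*` setT) (f x).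
  by rewrite /f; case: pselect => // nBx [/hAB|].
apply: (@set_inj_card_le _ _ _ _ (g \o f)) => [x /fB/gB//|x y].
rewrite !inE => ABx ABy /= /ginj; rewrite !inE => /(_ (fB _ ABx) (fB _ ABy)).
rewrite /f; case: pselect => Bx; case: pselect => By //= [] // hxy.
by apply: hinj => //; rewrite inE; [case: ABx|case: ABy].
Qed.

Lemma card_ltP (T : Type) (A B : set T) : reflect (~ (B #<= A)) (card_lt A B).
Proof.
rewrite /card_lt card_eq_le; apply: (iffP idP) => [/andP[->] /negP//|/negP nBA].
by have [->|/(negP nBA)] := card_le_total A B.
Qed.

Lemma card_lt_subset (T : Type) (A B C : set T) :
  A `<=` B -> card_lt B C -> card_lt A C.
Proof.
move=> AB /card_ltP nCB; apply/card_ltP => CA; apply: nCB.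
exact: card_le_trans CA (subset_card_le AB).
Qed.

(** If the larger of [A] and [B] is infinite, it absorbs the other; if it is finite, so is the
    union, while [C] is infinite. *)
Lemma card_lt_setU (T : Type) (A B C : set T) : infinite_set C ->
  card_lt A C -> card_lt B C -> card_lt (A `|` B) C.
Proof.
wlog AB : A B / A #<= B => [hwlog|].
  have [/hwlog//|/hwlog H] := card_le_total A B.
  by rewrite setUC => *; exact: H.
move=> Cinf _ /card_ltP nCB; apply/card_ltP => CAB.
have [Bfin|Binf] := pselect (finite_set B).
  apply: Cinf; apply: card_le_finite CAB _; rewrite finite_setU; split=> //.
  exact: card_le_finite AB Bfin.
exact/nCB/(card_le_trans CAB)/card_le_setU.
Qed.

Lemma card_lt_bigcup (T : Type) (I : choiceType) (D : set I) (F : I -> set T)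
    (C : set T) : infinite_set C -> finite_set D ->
  (forall i, D i -> card_lt (F i) C) -> card_lt (\bigcup_(i in D) F i) C.
Proof.
move=> Cinf Dfin FC; rewrite -bigsetU_fset_set// big_seq.
elim/big_ind : _ => [|A B|i].
- by apply/card_ltP => C0; exact/Cinf/(card_le_finite C0).
- exact: card_lt_setU.
- by rewrite in_fset_set// inE; exact: FC.
Qed.

(** * Topologies given by their open sets *)

Definition open_system (T : choiceType) (op : set (set T)) :=
  [/\ op setT, setI_closed op &
    forall (I : Type) (f : I -> set T),
      (forall i, op (f i)) -> op (\bigcup_i f i)].

(** An alias of [T] indexed by [opP], so that each system of open sets gets its own topological
    structure. *)
Definition retopologized (T : choiceType) (op : set (set T))
  (opP : open_system op) : Type := T.

HB.instance Definition _ T op opP := Choice.on (@retopologized T op opP).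
HB.instance Definition _ T op opP :=
  let: And3 opT opI opU := opP in
  isOpenTopological.Build (@retopologized T op opP) opT opI opU.

Lemma open_system_topology (T : choiceType) (op : set (set T)) :
  open_system op ->
  exists tau : Topological.axioms_ T, @open (Topological.Pack tau) = op.
Proof.
move=> opP; exists (Topological.class (retopologized opP)).
by case: (opP).
Qed.

(** * Chains of open sets, separation and covers *)

(** Without a base point, one chain serves every point of [U 1]: the sets increase, so the others
    contain that point too. *)
Definition chain (X : topologicalType) (n : nat) (U : nat -> set X) : Prop :=
  (forall i, (1 <= i <= n)%N -> open (U i)) /\
  (forall i, (1 <= i < n)%N -> closure (U i) `<=` U i.+1).

Definition separated (X : topologicalType) (n : nat) (x y : X) : Prop :=
  exists U : nat -> set X, [/\ chain n U, U 1%N x & ~ closure (U n) y].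

Lemma chain_le (X : topologicalType) (n : nat) (U : nat -> set X) (i j : nat) :
  chain n U -> (1 <= i)%N -> (i <= j)%N -> (j <= n)%N -> U i `<=` U j.
Proof.
move=> [_ clU] i1; elim: j => [|j IHj]; first by case: i i1.
rewrite leq_eqVlt => /orP[/eqP-> _|ij jn x Uix]; first exact: subset_refl.
apply: (clU j); first by rewrite jn (leq_trans i1).
exact/subset_closure/(IHj ij (ltnW jn)).
Qed.

Lemma nbhs_chainE (X : topologicalType) (n : nat) (x : X) (U : nat -> set X) :
  (0 < n)%N -> nbhs_chain n x U <-> chain n U /\ U 1%N x.
Proof.
move=> n0; split=> [[oU clU]|[[oU clU] U1x]].
  split; last exact: (oU 1%N n0).2.
  by split=> // i /oU[].
split=> // i /andP[i1 ni]; split; first by apply: oU; rewrite i1.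
exact: (@chain_le _ n U 1 i (conj oU clU)).
Qed.

Lemma S_spaceE (X : topologicalType) (n : nat) : (0 < n)%N ->
  S_space n X <-> forall x y : X, x <> y -> separated n x y.
Proof.
case: n => // n n0; split=> H x y /H.
  move=> /contrapT[U [/(nbhs_chainE _ _ n0)[cU Ux] Uy]].
  exists U; split=> // clUy.
  by have : (closure (U n.+1) `&` [set y]) y by []; rewrite Uy.
move=> [U [cU Ux nUy]]; apply; exists U; split; first exact/nbhs_chainE.
by apply/seteqP; split=> // z [+ zy]; rewrite zy.
Qed.

(** A chain of length [n.-1] whose last closure lies in a cover member [W] is prolonged by [W] to
    length [n]; conversely the last term is dropped. For [n = 1] the interior is the ordinary one
    and the chain is [W] alone. *)
Lemma S_coverE (X : topologicalType) (n : nat) (B : set X)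
    (gamma : set (set X)) : (0 < n)%N ->
  S_cover n.-1 B gamma <-> gamma `<=` open /\
    forall y, B y -> exists U, [/\ chain n U, U 1%N y & gamma (U n)].
Proof.
move=> n0; rewrite /S_cover; split=> -[og cov]; split=> // y /cov.
- move=> [W gW]; case: n n0 {cov} => // -[_|n _] /=.
    rewrite /theta_interior /theta_closure closure_setC setCK => Wy.
    exists (fun=> W); split=> //; last exact: interior_subset.
    by split=> [i _|[|i]//]; exact: og.
  rewrite /theta_interior /= => /contrapT[U [+ UW]].
  move=> /(nbhs_chainE _ _ (ltn0Sn n))[[oU cU] Uy].
  exists (fun i => if (i <= n.+1)%N then U i else W).
  rewrite /= ltnn; split=> //; split=> i /andP[i1 ilen].
    case: leqP => [iltn|_]; last exact: og.
    by apply: oU; rewrite i1.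
  have ilen1 : (i <= n.+1)%N by rewrite -ltnS.
  rewrite ilen1.
  case: ltnP => [iltn|nlei]; first by apply: cU; rewrite i1.
  have -> : i = n.+1 by apply/eqP; rewrite eqn_leq ilen1.
  by rewrite -(setCK W); apply/disjoints_subset.
- move=> [U [[oU cU] Uy gU]]; exists (U n) => //.
  case: n n0 {cov} oU cU gU => // -[_|n _] oU cU gU.
    rewrite /theta_interior /theta_closure closure_setC setCK.
    by apply: open_nbhs_nbhs; split=> //; exact: oU.
  rewrite /theta_interior /=; apply; exists U; split; last first.
    by apply/disjoints_subset; rewrite setCK; apply: cU; rewrite ltnSn.
  apply/nbhs_chainE => //; split=> //; split=> i /andP[i1 ilen].
    by apply: oU; rewrite i1 (leqW ilen).
  by apply: cU; rewrite i1 (leqW ilen).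
Qed.

(* Dualizing turns a chain at x whose last closure misses y into a chain at y
   whose last closure misses x. *)
Definition dual_chain (X : topologicalType) (n : nat) (U : nat -> set X)
  (i : nat) : set X := ~` closure (U (n.+1 - i)%N).

(** An open set lies in the interior of its closure. *)
Lemma closure_dual_chain (X : topologicalType) (n : nat) (U : nat -> set X)
    (i : nat) : chain n U -> (1 <= i <= n)%N ->
  closure (dual_chain n U i) `<=` ~` U (n.+1 - i)%N.
Proof.
move=> [oU _] /andP[i1 ilen]; rewrite /dual_chain closure_setC.
apply: subsetC; rewrite -open_subsetE; first exact: subset_closure.
apply: oU; lia.
Qed.

Lemma chain_dual (X : topologicalType) (n : nat) (U : nat -> set X) :
  chain n U -> chain n (dual_chain n U).
Proof.
move=> cU; split=> i /andP[i1 ilen].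
  by apply: closed_openC; exact: closed_closure.
apply: (subset_trans (closure_dual_chain cU _)); first by rewrite i1 ltnW.
apply: subsetC; rewrite subSS.
have -> : (n.+1 - i = (n - i).+1)%N by lia.
by apply: cU.2; lia.
Qed.

Lemma separated_sym (X : topologicalType) (n : nat) (x y : X) : (0 < n)%N ->
  separated n x y -> separated n y x.
Proof.
move=> n0 [U [cU Ux nUy]]; exists (dual_chain n U); split.
- exact: chain_dual.
- by rewrite /dual_chain subSS subn0.
- move=> /(closure_dual_chain cU); rewrite subSnn n0 leqnn; exact.
Qed.

Lemma separated_closed1 (X : topologicalType) (n : nat) (x : X) :
  (0 < n)%N -> (forall y, y <> x -> separated n y x) -> closed [set x].
Proof.
move=> n0 sepx y clxy; apply: contrapT => /sepx[U [cU Uy nUx]].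
have [|z [-> Ux]] := clxy (U 1%N).
  by apply: open_nbhs_nbhs; split=> //; exact: cU.1.
by apply: nUx; apply: subset_closure; exact: (chain_le cU _ n0 (leqnn n)) Ux.
Qed.

(** * Coarsening the topology at one point *)

Definition cofinite_closures (X : topologicalType) (gamma : set (set X))
    (W : set X) : Prop :=
  exists delta : set (set X), [/\ finite_set delta, delta `<=` gamma &
    ~` W `<=` \bigcup_(U in delta) closure U].

Definition coarsened (X : topologicalType) (x : X) (gamma : set (set X))
  : set (set X) :=
  [set W | open W /\ (W x -> cofinite_closures gamma W)].

(** The condition imposed at [x] passes to supersets, and to intersections by uniting the two finite
    families. *)
Lemma open_system_coarsened (X : topologicalType) (x : X)
  (gamma : set (set X)) : open_system (coarsened x gamma).
Proof.
split.
- split; [exact: openT|move=> _; exists set0; split=> //].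
  by rewrite setCT.
- move=> A B [oA cA] [oB cB]; split; first exact: openI.
  move=> [/cA[d [dfin dg Ad]] /cB[e [efin eg Be]]]; exists (d `|` e).
  split; first by rewrite finite_setU.
    by move=> U [/dg|/eg].
  by rewrite setCI bigcup_setU; exact: setUSS.
- move=> I f fop; split; first by apply: bigcup_open => i _; exact: (fop i).1.
  move=> [i _ /(fop i).2[d [dfin dg fd]]]; exists d; split=> //.
  by apply: subset_trans fd; apply: subsetC; exact: bigcup_sup.
Qed.

(** Open sets that miss [x] stay open in [Y], and [[set x]] is closed in [X]; so a closure can gain
    no point but [x]. *)
Lemma closure_coarsened (X : topologicalType) (n : nat) (x : X)
    (gamma : set (set X)) (tau : Topological.axioms_ X)
    (Y := Topological.Pack tau) (A : set X) : (0 < n)%N -> S_space n X ->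
  @open Y = coarsened x gamma -> @closure Y A `<=` closure A `|` [set x].
Proof.
move=> n0 SX openY z clz; apply: contrapT => nz.
have cl1 : closed [set x].
  by apply: (@separated_closed1 _ n) => // y; exact: (S_spaceE _ n0).1.
have : (@nbhs Y Y z) (~` (closure A `|` [set x])).
  apply: open_nbhs_nbhs; split => //; rewrite openY; split.
    by apply: closed_openC; apply: closedU cl1; exact: closed_closure.
  by case; right.
move=> /clz[t [At]]; apply; left; exact: subset_closure.
Qed.

Lemma separated_coarsened_point (X : topologicalType) (n : nat) (x : X)
    (gamma : set (set X)) (tau : Topological.axioms_ X)
    (Y := Topological.Pack tau) (y : X) : (0 < n)%N -> S_space n X ->
  @open Y = coarsened x gamma -> S_cover n.-1 (~` [set x]) gamma ->
  y <> x -> @separated Y n x y.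
Proof.
move=> n0 SX openY /(S_coverE _ _ n0)[_ cov] yx.
have [P [cP Px nPy]] := (S_spaceE X n0).1 SX _ _ (nesym yx).
have [V [cV Vy gV]] := cov _ yx.
have cQ := chain_dual cV.
(* Adding the dual of the chain V from y to V n in gamma makes the members of
   the chain P neighborhoods of x in the coarsened topology. *)
pose R i := P i `|` dual_chain n V i.
have Rx i : (1 <= i <= n)%N -> R i x.
  by move=> /andP[i1 ilen]; left; exact: (chain_le cP _ i1 ilen).
have clR i : (1 <= i <= n)%N -> @closure Y (R i) `<=` closure (R i).
  move=> iln z /(closure_coarsened n0 SX openY)[//|->].
  exact/subset_closure/Rx.
exists R; split; [split|exact: Rx|].
- move=> i iln; rewrite openY; split.
    by apply: openU; [exact: cP.1|exact: cQ.1].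
  (* The dual chain increases from its first term, the complement of the closure of [V n], so this
     one closure contains the complement of each [R i]. *)
  move=> _; exists [set V n]; split; [exact: finite_set1|by move=> _ ->|].
  rewrite bigcup_set1 setCU => z [_ nQ]; apply: contrapT => nclV; apply: nQ.
  case/andP: iln => i1 ilen; apply: (chain_le cQ _ i1 ilen) => //.
  by rewrite /dual_chain subSS subn0.
- move=> i /andP[i1 iltn]; apply: (subset_trans (clR _ _)).
    by rewrite i1 ltnW.
  rewrite closureU; apply: setUSS; [apply: cP.2|apply: cQ.2]; exact/andP.
- move=> /(clR n); rewrite n0 leqnn => /(_ isT); rewrite closureU => -[//|].
  by move=> /(closure_dual_chain cV); rewrite subSnn n0 leqnn; exact.
Qed.

Lemma S_space_coarsened (X : topologicalType) (n : nat) (x : X)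
    (gamma : set (set X)) (tau : Topological.axioms_ X)
    (Y := Topological.Pack tau) : (0 < n)%N -> S_space n X ->
  @open Y = coarsened x gamma -> S_cover n.-1 (~` [set x]) gamma ->
  S_space n Y.
Proof.
move=> n0 SX openY cov; apply/(S_spaceE _ n0) => y z yz.
have [zx|zx] := pselect (z = x).
  rewrite zx; apply: separated_sym => //.
  apply: (separated_coarsened_point n0 SX openY cov) => yx.
  by apply: yz; rewrite zx.
have [->|yx] := pselect (y = x).
  exact: (separated_coarsened_point n0 SX openY).
(* For two points other than [x], a chain of [X] separating them is intersected with a chain of [Y]
   separating [y] from [x]. The terms miss [x], hence are open in [Y], and [V] keeps [x] out of the
   closures that must fit into the next term. *)
have /(separated_sym n0)[V [cV Vy nVx]] :=
  separated_coarsened_point n0 SX openY cov yx.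
have [U [cU Uy nUz]] := (S_spaceE X n0).1 SX _ _ yz.
have clY := closure_coarsened n0 SX openY.
have nVx' i : (1 <= i <= n)%N -> ~ V i x.
  move=> /andP[i1 ilen] /(chain_le cV i1 ilen (leqnn n)) Vx.
  by apply: nVx; exact: subset_closure.
exists (fun i => U i `&` V i); split; [split|by []|].
- move=> i iln; rewrite openY; split; last by move=> [_ /(nVx' _ iln)].
  apply: openI; first exact: cU.1.
  by have := cV.1 i iln; rewrite openY => -[].
- move=> i iltn.
  have iln : (1 <= i.+1 <= n)%N by case/andP: iltn.
  move=> t clt; have Vt : V i.+1 t.
    by apply: (cV.2 i iltn); exact: closureS clt; apply: subIsetr.
  split=> //; apply: (cU.2 i iltn).
  have [|tx] := clY _ _ clt; first by move=> /closureI[].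
  by exfalso; apply: (nVx' _ iln); rewrite -tx.
- by move=> /(clY _)[/closureI[]|/zx].
Qed.

(** * Minimality and finite families of closures *)

Lemma minimal_S_space_cofinite_closures (X : topologicalType) (n : nat)
    (x : X) (gamma : set (set X)) (W : set X) : (0 < n)%N ->
  minimal_S_space n X -> S_cover n.-1 (~` [set x]) gamma -> open_nbhs x W ->
  cofinite_closures gamma W.
Proof.
move=> n0 [SX minX] cov [oW Wx].
have [tau openY] := open_system_topology (open_system_coarsened x gamma).
have : coarsened x gamma W; last by move=> [_]; exact.
apply: contrapT => nW; apply: minX; exists tau; split.
  exact: (S_space_coarsened n0 SX openY).
rewrite openY; split; first by move=> ? [].
by move=> /(_ W oW).
Qed.

Lemma cofinite_closures_minimal (X : topologicalType) (n : nat) : (0 < n)%N ->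
  S_space n X ->
  (forall (x : X) (gamma : set (set X)) (W : set X),
    S_cover n.-1 (~` [set x]) gamma -> open_nbhs x W ->
    cofinite_closures gamma W) ->
  minimal_S_space n X.
Proof.
move=> n0 SX H; split=> // -[tau]; set Y := Topological.Pack tau.
move=> [/(S_spaceE _ n0) SY [YX]]; apply=> W oW.
have clXY (A : set X) : closure A `<=` @closure Y A.
  move=> z clz B; rewrite nbhsE => -[C [oC Cz] CB].
  by have [|t [At Ct]] := clz C; [apply: open_nbhs_nbhs; split=> //; exact: YX
    |exists t; split=> //; exact: CB].
rewrite openE => x Wx.
(* These hulls of [Y] cover the complement of [x] because [Y] is S(n); their chains are chains of
   [X] because closures are smaller in [X]. *)
pose gamma := [set U | exists y, exists V : nat -> set X,
  [/\ @chain Y n V, V 1%N y, V n = U & ~ @closure Y U x]].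
have [||d [dfin dg Wd]] := H x gamma W.
- apply/(S_coverE _ _ n0); split.
    by move=> _ [y [V [[oV _] _ <- _]]]; apply: YX; apply: oV; rewrite n0 /=.
  move=> y yx; have [V [[oV cV] Vy nVx]] := SY _ _ yx.
  exists V; split=> //; last by exists y, V.
  split=> i iln; first exact/YX/oV.
  exact: subset_trans (clXY _) (cV i iln).
- by [].
(* The complement of this finite union is [Y]-open, contains [x] and lies in [W]. *)
have cld : @closed Y (\bigcup_(U in d) @closure Y U).
  by apply: closed_bigcup => // U _; exact: closed_closure.
rewrite /interior nbhsE; exists (~` \bigcup_(U in d) @closure Y U).
  split; first exact: closed_openC.
  by move=> [U /dg[y [V [_ _ _ nUx]]]].
by move=> z nd; apply: contrapT => /Wd[U dU /clXY Uz]; apply: nd; exists U.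
Qed.

(** * Convergence and accumulation of infinite sets *)

Lemma cofinite_closures_theta_converges (X : topologicalType) (n : nat)
    (A : set X) : (0 < n)%N -> infinite_set A ->
  (forall (x : X) (gamma : set (set X)) (W : set X),
    S_cover n.-1 (~` [set x]) gamma -> open_nbhs x W ->
    cofinite_closures gamma W) ->
  theta_converges n A [set x | theta_complete_accumulation n A x].
Proof.
move=> n0 Ainf H gamma /(S_coverE _ _ n0)[og cov].
pose sigma := [set U | open U /\ card_lt (A `&` closure U) A].
have cov' (y : X) :
    exists U, [/\ chain n U, U 1%N y & (gamma `|` sigma) (U n)].
  have [/cov[U [cU Uy gU]]|] := pselect (theta_complete_accumulation n A y).
    by exists U; split=> //; left.
  move=> /existsNP[_ /not_implyP[[U [/(nbhs_chainE _ _ n0)[cU Uy] <-]] nA]].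
  exists U; split=> //; right; split; first by apply: cU.1; rewrite n0 /=.
  by rewrite /card_lt (subset_card_le (@subIsetl _ _ _)); apply/negP.
(* The neighborhood of [a] is taken to be a cover member [U0 n]: adding it to the finite family
   makes the closures cover all of [X]. *)
have [a Aa] := infinite_setN0 Ainf.
have [U0 [cU0 U0a gU0]] := cov' a.
have [||d [dfin dg Ud]] := H a (gamma `|` sigma) (U0 n).
- apply/(S_coverE _ _ n0); split; first by move=> U [/og|[]].
  by move=> y _; exact: cov'.
- split; first by apply: cU0.1; rewrite n0 /=.
  exact: (chain_le cU0 _ n0 (leqnn n)).
pose d' := U0 n |` d.
have d'fin : finite_set d' by rewrite finite_setU; split.
have d'g : d' `<=` gamma `|` sigma by move=> U [->|/dg].
have d'T (y : X) : exists2 U, d' U & closure U y.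
  have [Uy|/Ud[U dU Uy]] := pselect (U0 n y).
    by exists (U0 n); [left|exact: subset_closure].
  by exists U; [right|].
exists (d' `&` gamma); split; [exact: finite_setIl|exact: subIsetr|].
(* Points of [A] missed by the members from [gamma] lie in finitely many sets smaller than [A]. *)
apply: (@card_lt_subset _ _ (\bigcup_(U in d' `&` sigma) (A `&` closure U))).
  move=> y [Ay nUy]; have [U dU Uy] := d'T y; exists U => //; split=> //.
  by have [gU|//] := d'g _ dU; exfalso; apply: nUy; exists U.
apply: card_lt_bigcup => //; first exact: finite_setIl.
by move=> U [_ []].
Qed.

(** If a neighborhood [W] of [x] met [A] in a smaller set, finitely many closures from any cover
    would miss only points of that set. *)
Lemma cofinite_closures_complete_accumulation (X : topologicalType) (n : nat)
    (A : set X) (x : X) :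
  (forall (gamma : set (set X)) (W : set X),
    S_cover n.-1 (~` [set x]) gamma -> open_nbhs x W ->
    cofinite_closures gamma W) ->
  ~ theta_converges n A (~` [set x]) -> complete_accumulation A x.
Proof.
move=> H nA W Wx; apply: contra_notP nA => nAW gamma /H/(_ Wx)[d [dfin dg Wd]].
exists d; split=> //; apply: (@card_lt_subset _ _ (A `&` W)).
  move=> y [Ay nd]; split=> //; apply: contrapT => /Wd; exact: nd.
by rewrite /card_lt (subset_card_le (@subIsetl _ _ _)); apply/negP.
Qed.

Lemma complete_accumulation_cofinite_closures (X : topologicalType) (n : nat)
    (x : X) (gamma : set (set X)) (W : set X) : (0 < n)%N ->
  (forall A : set X, infinite_set A -> ~ theta_converges n A (~` [set x]) ->
    complete_accumulation A x) ->
  S_cover n.-1 (~` [set x]) gamma -> open_nbhs x W ->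
  cofinite_closures gamma W.
Proof.
move=> n0 H cov [oW Wx].
pose covered (B : set X) := exists delta : set (set X),
  [/\ finite_set delta, delta `<=` gamma &
      B `<=` \bigcup_(U in delta) closure U].
apply: contrapT => nW.
pose I := {B : set X | B `<=` ~` W /\ ~ covered B}.
have [[A [AW nA]] /= minA] :=
  card_le_min (exist _ (~` W) (conj (@subset_refl _ _) nW) : I) sval.
have Ainf : infinite_set A.
  move=> Afin; apply: nA.
  (* Points of [A] lie outside [W], so they differ from [x] and are covered; [setT] is a default
     value off [A]. *)
  have /choice[f fP] : forall y, exists U, A y -> gamma U /\ closure U y.
    move=> y; have [/AW nWy|nAy] := pselect (A y); last by exists setT.
    have [|U [cU Uy gU]] := ((S_coverE _ _ n0).1 cov).2 y.
      by move=> yx; apply: nWy; rewrite yx.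
    exists (U n) => _; split=> //.
    exact/subset_closure/(chain_le cU _ n0 (leqnn n)).
  exists (f @` A); split; first exact: finite_image.
    by move=> _ [y /fP[gU _] <-].
  by move=> y Ay; exists (f y); [exists y|exact: (fP y Ay).2].
have : theta_converges n A (~` [set x]).
  apply: contrapT => /(H _ Ainf)/(_ W (conj oW Wx)).
  have -> : A `&` W = set0 by apply/disjoints_subset.
  move=> A0; apply: Ainf; move: A0; rewrite card_eq_sym card_eq0 => /eqP->.
  exact: finite_set0.
move=> /(_ gamma cov)[d [dfin dg /card_ltP nAd]].
have [e [efin eg Ae]] : covered (A `\` \bigcup_(U in d) closure U).
  apply: contrapT => nc; apply: nAd.
  have sW : A `\` \bigcup_(U in d) closure U `<=` ~` W by move=> y [/AW].
  exact: (minA (exist _ _ (conj sW nc))).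
apply: nA; exists (d `|` e); split.
- by rewrite finite_setU.
- by move=> U [/dg|/eg].
- rewrite bigcup_setU => y Ay.
  have [|ny] := pselect ((\bigcup_(U in d) closure U) y); first by left.
  by right; apply: Ae; split.
Qed.

Theorem theorem5p2 (n : nat) (hn : (1 <= n)%N) (X : topologicalType)
    (hX : S_space n X) :
  minimal_S_space n X <->
  (forall A : set X, infinite_set A ->
     theta_converges n A [set x | theta_complete_accumulation n A x] /\
     (forall x : X, ~ theta_converges n A (~` [set x]) ->
        complete_accumulation A x)).
Proof.
split=> [minX A Ainf|H].
  have cX x gamma W := @minimal_S_space_cofinite_closures X n x gamma W hn minX.
  split=> [|x]; first exact: cofinite_closures_theta_converges.
  by apply: cofinite_closures_complete_accumulation => gamma W; exact: cX.
apply: cofinite_closures_minimal => // x gamma W.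
apply: complete_accumulation_cofinite_closures => // A /H[_].
exact.
Qed.
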